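(* Suppose that $W$ satisfies the network assumption, that each $f_i:\mathbb{R}^n\to\mathbb{R}$, $i=1,\dots,N$, is twice differentiable and $\mu$-strongly convex with $\mu>0$, and that $\|\nabla^2 f_i(y)\|\le l_i$ for every $y\in\mathbb{R}^n$ and $i=1,\dots,N$. Let $\{\theta_s\}$ be a sequence of positive penalty parameters with $\theta_s\to\infty$ and let $\{\varepsilon_s\}$ be a positive sequence with $\varepsilon_s\to0$. Let $\{\mathbf{x}^s\}$ be a sequence generated by Algorithm EFIX-G with $$k(s)=\left\lceil \left|\frac{\log(\mu\varepsilon_{s+1})-\log\big((L+2\theta_{s+1})(\varepsilon_s+\bar c_s+\bar c_{s+1})\big)}{\log(\rho_{s+1})}\right|\right\rceil ,$$ where $\rho_{s+1}$ is a constant such that $\|\mathbb{M}_{s+1}\|\le\rho_{s+1}<1$ and $\bar c_s=\|\mathbf{c}_s\|$. Consider the problem $$(P)\qquad \min_{\mathbf{x}\in\mathbb{R}^{nN}} F(\mathbf{x})=\sum_{i=1}^N f_i(x_i)\quad\text{s.t.}\quad (\mathbb{I}-\mathbb{W})^{1/2}\mathbf{x}=0.$$ If $\{\mathbf{x}^s\}$ is bounded, then every accumulation point of $\{\mathbf{x}^s\}$ is feasible for $(P)$. Furthermore, if $\lim_{s\to\infty}\mathbf{x}^s=\mathbf{x}^*=(x_1^*;\dots;x_N^* )$, then $\mathbf{x}^*$ is the solution of $(P)$, i.e., $x_i^*$ is the solution of $\min_{y\in\mathbb{R}^n}\sum_{j=1}^N f_j(y)$ for every $i=1,\dots,N$.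
   Context: Network assumption: $W=[w_{ij}]\in\mathbb{R}^{N\times N}$ is symmetric and doubly stochastic, with $w_{ij}>0$ if $j\in\bar O_i$ and $w_{ij}=0$ if $j\notin \bar O_i$, where $\bar O_i=O_i\cup\{i\}$ and $O_i$ is the set of neighbours of node $i$ in an undirected connected graph on the $N$ nodes. Notation: vectors $\mathbf{x}=(x_1;\dots;x_N)\in\mathbb{R}^{nN}$ with $x_i\in\mathbb{R}^n$; $\mathbb{I}$ is the identity on $\mathbb{R}^{nN}$, $\mathbb{W}=W\otimes I$ with $I$ the $n\times n$ identity, $\mathbb{L}=\mathbb{I}-\mathbb{W}$; $L=\max_i l_i$; $\bar w=\max_i w_{ii}<1$; $\|\cdot\|$ is the Euclidean norm (and the induced matrix norm). For $s\ge1$, the quadratic model of the penalty function $F(\mathbf{x})+\frac{\theta_s}{2}\mathbf{x}^T\mathbb{L}\mathbf{x}$ at outer iteration $s$ is $$Q_s(\mathbf{x})=F(\mathbf{x}^{s-1})+\nabla^T F(\mathbf{x}^{s-1})(\mathbf{x}-\mathbf{x}^{s-1})+\tfrac12(\mathbf{x}-\mathbf{x}^{s-1})^T\nabla^2F(\mathbf{x}^{s-1})(\mathbf{x}-\mathbf{x}^{s-1})+\tfrac{\theta_s}{2}\mathbf{x}^T\mathbb{L}\mathbf{x},$$ so that $\nabla Q_s(\mathbf{x})=\mathbb{A}_s\mathbf{x}-\mathbf{c}_s$ with $$\mathbb{A}_s=\nabla^2F(\mathbf{x}^{s-1})+\theta_s\mathbb{L},\qquad \mathbf{c}_s=\nabla^2F(\mathbf{x}^{s-1})\mathbf{x}^{s-1}-\nabla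 F(\mathbf{x}^{s-1}).$$ JOR (Jacobi Over-Relaxation) iteration for $\mathbb{A}_s\mathbf{x}=\mathbf{c}_s$: $\mathbb{D}_s$ is the diagonal matrix with the same diagonal as $\mathbb{A}_s$, $\mathbb{G}_s=\mathbb{D}_s-\mathbb{A}_s$, $q_s$ is a relaxation parameter with $0<q_s<\frac{2\theta_s(1-\bar w)}{L+2\theta_s}$, $\mathbb{M}_s=q_s\mathbb{D}_s^{-1}\mathbb{G}_s+(1-q_s)\mathbb{I}$, $\mathbf{p}_s=q_s\mathbb{D}_s^{-1}\mathbf{c}_s$. Algorithm EFIX-G: given $\{\theta_s\}$, an initial point $\mathbf{x}^0\in\mathbb{R}^{nN}$ and inner iteration counts $\{k(s)\}$, for $s=0,1,2,\dots$ the outer step from $\mathbf{x}^s$ sets $\mathbf{z}^0=\mathbf{x}^s$, performs $\mathbf{z}^{k+1}=\mathbb{M}_{s+1}\mathbf{z}^k+\mathbf{p}_{s+1}$ for $k=0,\dots,k(s)-1$, and sets $\mathbf{x}^{s+1}=\mathbf{z}^{k(s)}$. The formula for $k(s)$ is used for $s\ge1$ (where $\mathbf{c}_s$ is defined); $k(0)$ is an arbitrary given natural number. *)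

(* Defs.v *)
From HB Require Import structures.
From mathcomp Require Import all_boot all_order all_algebra.
From mathcomp Require Import all_classical all_reals all_analysis.

Set Implicit Arguments.
Unset Strict Implicit.
Unset Printing Implicit Defensive.

Import Order.TTheory GRing.Theory Num.Theory.
Import numFieldNormedType.Exports.

Local Open Scope classical_set_scope.
Local Open Scope ring_scope.

Section Euclidean.
Context {R : realType}.

(* The norm of 'M[R]_(m, n) in the library is the maximum norm. *)
Definition enorm {m} (x : 'cV[R]_m) : R := Num.sqrt (\sum_i x i 0 ^+ 2).

Definition opnorm {m n} (A : 'M[R]_(m, n)) : R :=
  sup [set enorm (A *m x) | x in [set x : 'cV[R]_n | enorm x <= 1]].

Definition gradient {m} (f : 'cV[R]_m -> R) (x : 'cV[R]_m) : 'cV[R]_m :=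
  \col_i 'D_(delta_mx i 0) f x.

Definition hessian {m} (f : 'cV[R]_m -> R) (x : 'cV[R]_m) : 'M[R]_m :=
  \matrix_(i, j) ('D_(delta_mx j 0) (gradient f) x) i 0.

Definition twice_differentiable {m} (f : 'cV[R]_m -> R) : Prop :=
  (forall x, differentiable f x) /\ (forall x, differentiable (gradient f) x).

Definition strongly_convex {m} (mu : R) (f : 'cV[R]_m -> R) : Prop :=
  forall (x y : 'cV[R]_m) (t : R), 0 <= t <= 1 ->
    f (t *: x + (1 - t) *: y) <=
    t * f x + (1 - t) * f y - mu / 2 * t * (1 - t) * enorm (x - y) ^+ 2.

Definition argmin {T : Type} (A : set T) (f : T -> R) : set T :=
  [set x | A x /\ forall y, A y -> f x <= f y].

Definition psdmx {m} (S : 'M[R]_m) : Prop :=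
  S^T = S /\ forall x : 'cV[R]_m, 0 <= (x^T *m S *m x) 0 0.

(* The square root of a positive semidefinite matrix: its unique positive
   semidefinite square root (0 for a matrix which has none). *)
Definition sqrtmx {m} (A : 'M[R]_m) : 'M[R]_m :=
  xget 0 [set S | psdmx S /\ S *m S = A].

End Euclidean.

Section Network.
Context {R : realType} {N : nat}.

Definition doubly_stochastic (W : 'M[R]_N) : Prop :=
  [/\ forall i j, 0 <= W i j,
      forall i, \sum_j W i j = 1 &
      forall j, \sum_i W i j = 1].

(* e is the adjacency relation of the graph. *)
Record network_assumption (e : rel 'I_N) (W : 'M[R]_N) : Prop := {
  graph_undirected : symmetric e;
  graph_connected : forall i j, connect e i j;
  weights_symmetric : W^T = W;
  weights_stochastic : doubly_stochastic W;
  weights_pos : forall i j, (j == i) || e i j -> 0 < W i j;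
  weights_zero : forall i j, ~~ ((j == i) || e i j) -> W i j = 0 }.

(* Maxima over 'I_N. The base value 0 does not matter: N is positive and the
   families the maximum is taken of are nonnegative. *)
Definition maxI (l : 'I_N -> R) : R := \big[Num.max/0]_(i < N) l i.

Definition wbar (W : 'M[R]_N) : R := maxI (fun i => W i i).

End Network.

Section EFIX.
Context {R : realType} {N n : nat}.

(* R^(nN), as block columns; the i-th block of x is submxcol x i. *)
Local Notation vec := 'cV[R]_(\sum_(i < N) n).
Local Notation mat := 'M[R]_(\sum_(i < N) n).

Implicit Types (W : 'M[R]_N) (f : 'I_N -> 'cV[R]_n -> R).
Implicit Types (x z : vec) (A : mat) (c : vec).

Definition block x (i : 'I_N) : 'cV[R]_n := submxcol x i.

(* W (x) I, by blocks *)
Definition kronI W : mat :=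
  \mxblock_(i < N, j < N) ((W i j)%:M : 'M[R]_n).

Definition laplacian W : mat := 1%:M - kronI W.

Definition objective f x : R := \sum_(i < N) f i (block x i).

Definition feasible W : set vec := [set x | sqrtmx (laplacian W) *m x = 0].

(* The matrix and right-hand side of the linear system grad Q = 0, where Q is
   the quadratic model at x of the penalty function with parameter theta. *)
Definition sysmx W f (theta : R) x : mat :=
  hessian (objective f) x + theta *: laplacian W.

Definition sysrhs f x : vec :=
  hessian (objective f) x *m x - gradient (objective f) x.

Definition diagpart A : mat := diag_mx (\row_i A i i).

Definition jor_mx (q : R) A : mat :=
  q *: (invmx (diagpart A) *m (diagpart A - A)) + (1 - q) *: 1%:M.

Definition jor_vec (q : R) A c : vec := q *: (invmx (diagpart A) *m c).

Definition jor_step (q : R) A c z : vec := jor_mx q A *m z + jor_vec q A c.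

(* For s >= 1 these are A_s, c_s and M_s; the values at s = 0 are junk. *)
Definition A_ W f (theta : nat -> R) (x : nat -> vec) (s : nat) : mat :=
  sysmx W f (theta s) (x s.-1).

Definition c_ f (x : nat -> vec) (s : nat) : vec := sysrhs f (x s.-1).

Definition M_ W f (theta q : nat -> R) (x : nat -> vec) (s : nat) : mat :=
  jor_mx (q s) (A_ W f theta x s).

Definition EFIX_G W f (theta q : nat -> R) (k : nat -> nat) (x : nat -> vec) :
    Prop :=
  forall s, x s.+1 =
    iter (k s) (jor_step (q s.+1) (A_ W f theta x s.+1) (c_ f x s.+1)) (x s).

End EFIX.

(* Main.v *)
Require Import Defs.
From HB Require Import structures.
From mathcomp Require Import all_boot all_order all_algebra.
From mathcomp Require Import all_classical all_reals all_analysis.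
From mathcomp Require Import ring lra.

Set Implicit Arguments.
Unset Strict Implicit.
Unset Printing Implicit Defensive.

Import Order.TTheory GRing.Theory Num.Theory.
Import numFieldNormedType.Exports.

Local Open Scope classical_set_scope.
Local Open Scope ring_scope.

(** Writing [r_s = A_s x_s - c_s] for the residual of the linear system at outer
    step [s], the inner iteration contracts towards the solution of
    [A_(s+1) y = c_(s+1)], and the choice of [k s] turns [|r_s| <= T eps_s] into
    [|r_(s+1)| <= T eps_(s+1)] for every [T >= 1]. Since [k 0] is arbitrary, [T]
    absorbs the first residual, and [r_s] tends to [0]. If [x_s] is bounded, then so
    is [theta_s (I - W) x_s = r_s - H (x_s - x_(s-1)) - grad F (x_(s-1))], where [H]
    is the Hessian of [F] at [x_(s-1)]; hence [(I - W) x_s] tends to [0] and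
    accumulation points are feasible. Pairing the same identity with a
    feasible [y] removes the penalty term, so that [<y, grad F x*> = 0] in the limit,
    and strong convexity concludes. *)

Lemma cvg_sum {R : realType} {T : Type} {F : set_system T} {FF : Filter F}
    (I : finType) (f : I -> T -> R) (a : I -> R) :
  (forall i, f i t @[t --> F] --> a i) ->
  \sum_i f i t @[t --> F] --> \sum_i a i.
Proof. by move=> fa; apply: cvg_big => //; apply: add_continuous. Qed.

(** * Euclidean inner product, Euclidean norm and induced matrix norm *)

Section EuclideanSpace.
Context {R : realType}.

Definition dot {m} (u v : 'cV[R]_m) : R := (u^T *m v) 0 0.

Section Dot.
Context {m : nat}.
Implicit Types (u v w x y : 'cV[R]_m) (a : R).

Lemma dotE u v : dot u v = \sum_i u i 0 * v i 0.
Proof. by rewrite /dot mxE; apply: eq_bigr => i _; rewrite mxE. Qed.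

Lemma dotC u v : dot u v = dot v u.
Proof. by rewrite !dotE; apply: eq_bigr => i _; rewrite mulrC. Qed.

Lemma dotDr u v w : dot u (v + w) = dot u v + dot u w.
Proof. by rewrite /dot mulmxDr mxE. Qed.

Lemma dotDl u v w : dot (u + v) w = dot u w + dot v w.
Proof. by rewrite dotC dotDr !(dotC w). Qed.

Lemma dotZr a u v : dot u (a *: v) = a * dot u v.
Proof. by rewrite /dot -scalemxAr mxE. Qed.

Lemma dotZl a u v : dot (a *: u) v = a * dot u v.
Proof. by rewrite dotC dotZr dotC. Qed.

Lemma dotNr u v : dot u (- v) = - dot u v.
Proof. by rewrite -scaleN1r dotZr mulN1r. Qed.

Lemma dotNl u v : dot (- u) v = - dot u v.
Proof. by rewrite dotC dotNr dotC. Qed.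

Lemma dotBr u v w : dot u (v - w) = dot u v - dot u w.
Proof. by rewrite dotDr dotNr. Qed.

Lemma dotBl u v w : dot (u - v) w = dot u w - dot v w.
Proof. by rewrite dotDl dotNl. Qed.

Lemma dot0r u : dot u 0 = 0.
Proof. by rewrite /dot mulmx0 mxE. Qed.

Lemma dot_delta u i : dot u (delta_mx i 0) = u i 0.
Proof.
rewrite dotE (bigD1 i) //= big1 => [|j ji]; rewrite !mxE ?eqxx ?mulr1 ?addr0 //.
by rewrite (negPf ji) mulr0.
Qed.

Lemma dot_sumr (I : finType) (F : I -> 'cV[R]_m) u :
  dot u (\sum_i F i) = \sum_i dot u (F i).
Proof. by rewrite /dot mulmx_sumr summxE. Qed.

Lemma enorm_sqr x : enorm x ^+ 2 = dot x x.
Proof.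
rewrite /enorm sqr_sqrtr ?sumr_ge0 // => [|i _]; last exact: sqr_ge0.
by rewrite dotE; apply: eq_bigr => i _; rewrite expr2.
Qed.

Lemma enorm_ge0 x : 0 <= enorm x.
Proof. exact: sqrtr_ge0. Qed.
Hint Resolve enorm_ge0 : core.

Lemma dot_ge0 x : 0 <= dot x x.
Proof. by rewrite -enorm_sqr sqr_ge0. Qed.

Lemma ler_coord_enorm x i : `|x i 0| <= enorm x.
Proof.
rewrite -sqrtr_sqr ler_wsqrtr // (bigD1 i) //= lerDl sumr_ge0 // => j _.
exact: sqr_ge0.
Qed.

Lemma enorm_eq0 x : (enorm x == 0) = (x == 0).
Proof.
apply/eqP/eqP => [x0|->].
  apply/colP => i; have := ler_coord_enorm x i.
  by rewrite x0 normr_le0 mxE => /eqP.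
by rewrite /enorm big1 ?sqrtr0 // => i _; rewrite mxE expr0n.
Qed.

Lemma enorm0 : enorm (0 : 'cV[R]_m) = 0.
Proof. by apply/eqP; rewrite enorm_eq0. Qed.

Lemma cauchy_schwarz x y : `|dot x y| <= enorm x * enorm y.
Proof.
have [->|y0] := eqVneq y 0; first by rewrite dot0r normr0 mulr_ge0.
have yy : 0 < dot y y by rewrite -enorm_sqr exprn_gt0 // lt0r enorm_eq0 y0 /=.
rewrite -ler_sqr ?nnegrE ?mulr_ge0 // real_normK ?num_real //.
rewrite exprMn !enorm_sqr -(ler_pM2l yy).
(* The squared norm of this vector is [dot y y * (dot x x * dot y y - dot x y ^+ 2)]. *)
have := dot_ge0 (dot y y *: x - dot x y *: y).
rewrite dotBl !dotBr !dotZl !dotZr (dotC y x); nra.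
Qed.

Lemma ler_enormD x y : enorm (x + y) <= enorm x + enorm y.
Proof.
rewrite -ler_sqr ?nnegrE ?addr_ge0 // sqrrD !enorm_sqr dotDl !dotDr (dotC y x).
by have := le_trans (ler_norm _) (cauchy_schwarz x y); lra.
Qed.

Lemma enormZ a x : enorm (a *: x) = `|a| * enorm x.
Proof.
apply/eqP; rewrite -(@eqrXn2 _ 2) ?mulr_ge0 //.
by rewrite exprMn !enorm_sqr dotZl dotZr real_normK ?num_real // mulrA.
Qed.

Lemma enormN x : enorm (- x) = enorm x.
Proof. by rewrite -scaleN1r enormZ normrN1 mul1r. Qed.

Lemma enormB x y : enorm (x - y) = enorm (y - x).
Proof. by rewrite -enormN opprB. Qed.

Lemma ler_enormB x y : enorm (x - y) <= enorm x + enorm y.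
Proof. by rewrite -(enormN y) ler_enormD. Qed.

Lemma continuous_enorm : continuous (@enorm R m).
Proof.
move=> x; apply: (@continuous_comp _ _ _ (fun y => \sum_i y i 0 ^+ 2)); last first.
  exact: sqrt_continuous.
apply: (@cvg_sum _ _ (nbhs x) (nbhs_filter x)) => i.
have c := @coord_continuous R m 1 i 0 x.
exact: (cvgM c c).
Qed.

End Dot.

Lemma dot_mulmxr m p (A : 'M[R]_(m, p)) u v :
  dot u (A *m v) = dot (A^T *m u) v.
Proof. by rewrite /dot trmx_mul trmxK mulmxA. Qed.

Lemma dot_mulmxl m p (A : 'M[R]_(m, p)) u v :
  dot (A *m v) u = dot v (A^T *m u).
Proof. by rewrite dotC dot_mulmxr dotC. Qed.

(** The constant is the Frobenius norm, by Cauchy-Schwarz on each row. Its finiteness makes the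
    [sup] in [opnorm] a genuine supremum. *)
Lemma mulmx_enorm_bounded m p (A : 'M[R]_(m, p)) :
  exists C, forall x, enorm (A *m x) <= C * enorm x.
Proof.
exists (Num.sqrt (\sum_i dot (row i A)^T (row i A)^T)) => x.
have S0 : 0 <= \sum_i dot (row i A)^T (row i A)^T.
  by apply: sumr_ge0 => i _; apply: dot_ge0.
rewrite -ler_sqr ?nnegrE ?mulr_ge0 ?sqrtr_ge0 ?enorm_ge0 //.
rewrite exprMn 2!enorm_sqr sqr_sqrtr // dotE mulr_suml ler_sum // => i _.
have -> : (A *m x) i 0 = dot (row i A)^T x.
  by rewrite dotE mxE; apply: eq_bigr => j _; rewrite !mxE.
rewrite -expr2 -real_normK ?num_real // -!enorm_sqr -exprMn.
by rewrite ler_sqr ?nnegrE ?mulr_ge0 ?enorm_ge0 // cauchy_schwarz.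
Qed.

Lemma has_sup_opnorm m p (A : 'M[R]_(m, p)) :
  has_sup [set enorm (A *m x) | x in [set x : 'cV[R]_p | enorm x <= 1]].
Proof.
split; first by exists (enorm (A *m 0)), 0 => //=; rewrite enorm0.
have [C AC] := mulmx_enorm_bounded A; exists `|C| => _ [x /= x1 <-].
apply: (le_trans (AC x)); apply: (le_trans (ler_norm _)).
by rewrite normrM (ger0_norm (enorm_ge0 x)) ler_piMr.
Qed.

Lemma opnorm_ge0 m p (A : 'M[R]_(m, p)) : 0 <= opnorm A.
Proof.
apply: (ub_le_sup (has_sup_opnorm A).2).
by exists 0; rewrite /= ?mulmx0 enorm0.
Qed.

Lemma ler_opnorm m p (A : 'M[R]_(m, p)) x :
  enorm (A *m x) <= opnorm A * enorm x.
Proof.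
have [->|x0] := eqVneq x 0; first by rewrite mulmx0 !enorm0 mulr0.
have xg0 : 0 < enorm x by rewrite lt0r enorm_eq0 x0 enorm_ge0.
rewrite -ler_pdivrMr // mulrC -[leLHS](_ : enorm (A *m ((enorm x)^-1 *: x)) = _).
  apply: (ub_le_sup (has_sup_opnorm A).2).
  exists ((enorm x)^-1 *: x) => //=.
  by rewrite enormZ ger0_norm ?invr_ge0 ?enorm_ge0 // mulVf ?gt_eqF.
by rewrite -scalemxAr enormZ ger0_norm // invr_ge0 enorm_ge0.
Qed.

End EuclideanSpace.
#[export] Hint Resolve enorm_ge0 : core.

(** * Linear maps and derivatives along lines *)

Section LinearMaps.
Context {R : realType}.

Fact dot_is_linear m (u : 'cV[R]_m) : linear (dot u).
Proof. by move=> a x y; rewrite dotDr dotZr. Qed.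

HB.instance Definition _ m (u : 'cV[R]_m) :=
  GRing.isLinear.Build R 'cV[R]_m R _ (dot u) (@dot_is_linear m u).

Lemma continuous_dot m (u : 'cV[R]_m) : continuous (dot u).
Proof.
rewrite (_ : dot u = fun y => \sum_i u i 0 * y i 0); last first.
  by apply/funext => y; exact: dotE.
move=> x.
apply: (@cvg_sum _ _ (nbhs x) (nbhs_filter x)) => i.
exact: (cvgM (cvg_cst _) (@coord_continuous R m 1 i 0 x)).
Qed.

Lemma continuous_mulmx m p (A : 'M[R]_(m, p)) :
  continuous (mulmx A : 'cV[R]_p -> 'cV[R]_m).
Proof.
move=> x; apply: differentiable_continuous.
rewrite (_ : mulmx A = \sum_i (fun y : 'cV[R]_p => y i 0 *: col i A)).
  by apply: differentiable_sum => i; apply/differentiableZl/differentiable_coord.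
apply/funext => y; rewrite fct_sumE; apply/colP => i.
by rewrite !mxE summxE; apply: eq_bigr => j _; rewrite !mxE mulrC.
Qed.

Lemma linear_colE m (V : lmodType R) (g : {linear 'cV[R]_m -> V}) v :
  g v = \sum_i v i 0 *: g (delta_mx i 0).
Proof.
rewrite [in LHS](matrix_sum_delta v) linear_sum; apply: eq_bigr => i _.
by rewrite big_ord1 linearZ.
Qed.

Lemma differentiable_is_derive_line (V W : normedModType R) (f : V -> W) x v t :
  differentiable f (x + t *: v) ->
  is_derive t 1 (fun t => f (x + t *: v)) ('d f (x + t *: v) v).
Proof.
move=> df; have dl : is_diff t (fun t : R => x + t *: v) ( *:%R^~ v).
  by have := is_diffD (is_diff_cst x t) (is_diff_scalel t v); rewrite add0r.
have dl' : differentiable (fun t : R => x + t *: v) t by [].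
have dc := differentiable_comp dl' df.
apply: DeriveDef; first exact: diff_derivable.
by rewrite deriveE // (diff_comp dl' df) /= diff_val /= scale1r.
Qed.

End LinearMaps.

(** * Gradients, Hessians and strong convexity *)

Section Gradient.
Context {R : realType} {m : nat}.
Implicit Types (f : 'cV[R]_m -> R) (x y u v : 'cV[R]_m).

Lemma diff_gradient f x v :
  differentiable f x -> 'd f x v = dot (gradient f x) v.
Proof.
move=> df; rewrite linear_colE dotE; apply: eq_bigr => i _.
by rewrite mxE deriveE // mulrC.
Qed.

Lemma diff_hessian f x v :
  differentiable (gradient f) x -> 'd (gradient f) x v = hessian f x *m v.
Proof.
move=> df; rewrite linear_colE; apply/colP => i; rewrite summxE mxE.
by apply: eq_bigr => j _; rewrite !mxE deriveE // mulrC.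
Qed.

Lemma gradient_eq f x u :
  differentiable f x -> (forall v, 'd f x v = dot u v) -> gradient f x = u.
Proof.
move=> df fu; apply/colP => i.
by rewrite -dot_delta -diff_gradient // fu dot_delta.
Qed.

(** Pairing with a fixed [u] gives a real function of one variable, to which the mean value theorem
    and one-sided limits apply. *)
Lemma is_derive_dot_gradient f x u v (t : R) :
  (forall y, differentiable (gradient f) y) ->
  is_derive t 1 (fun t => dot u (gradient f (x + t *: v)))
    (dot u (hessian f (x + t *: v) *m v)).
Proof.
move=> df; have dd y : differentiable (dot u) y.
  exact: linear_differentiable (@continuous_dot _ _ u).
have := @differentiable_is_derive_line _ _ _ (dot u \o gradient f) x v t.
move=> /(_ (differentiable_comp (df _) (dd _))).
rewrite (diff_comp (df _) (dd _)) /= diff_lin; last exact: continuous_dot.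
by rewrite diff_hessian.
Qed.

(* Mean value theorem for [t |-> <u, gradient f (y + t (x - y))>] with
   [u := gradient f x - gradient f y]. *)
Lemma gradient_lipschitz f (C : R) :
  (forall y, differentiable (gradient f) y) ->
  (forall y v, enorm (hessian f y *m v) <= C * enorm v) ->
  forall x y, enorm (gradient f x - gradient f y) <= C * enorm (x - y).
Proof.
move=> df HC x y; set u := gradient f x - gradient f y.
have [u0|u0] := eqVneq u 0.
  by rewrite u0 enorm0 (le_trans _ (HC 0 (x - y))) ?enorm_ge0.
have ug0 : 0 < enorm u by rewrite lt0r enorm_eq0 u0 enorm_ge0.
have D t := @is_derive_dot_gradient f y u (x - y) t df.
have [|c _] := @MVT_segment R _ _ 0 1 ler01 (fun t _ => D t).
  apply: derivable_within_continuous => t _.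
  by have [] := D t.
rewrite scale1r scale0r addr0 subr0 mulr1 addrCA subrr addr0 -dotBr -/u.
rewrite -enorm_sqr => E; rewrite -(ler_pM2l ug0) -expr2 E.
apply: (le_trans (ler_norm _)); apply: (le_trans (cauchy_schwarz _ _)).
by rewrite ler_pM2l.
Qed.

(** Strong convexity on the segment from [x] to [y] bounds the difference quotient of [f] at [x] in
    direction [y - x] by [f y - f x - mu / 2 * (1 - t) * enorm (y - x) ^+ 2]; then [t] tends to [0]
    from the right. *)
Lemma strongly_convex_gradient f mu x y :
  differentiable f x -> strongly_convex mu f ->
  f x + dot (gradient f x) (y - x) + mu / 2 * enorm (y - x) ^+ 2 <= f y.
Proof.
move=> df cvx; have := @diff_derivable _ _ _ f x (y - x) df => /cvg_ex[l].
move=> cl; have ld : l = dot (gradient f x) (y - x).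
  by rewrite -diff_gradient // -deriveE //; apply/esym/cvg_lim.
have {}cl := cvg_dnbhs_at_right cl.
have cr : f y - f x - mu / 2 * (1 - t) * enorm (y - x) ^+ 2 @[t --> (0 : R)^'+]
    --> f y - f x - mu / 2 * (1 - 0) * enorm (y - x) ^+ 2.
  apply: cvg_at_right_filter; apply: cvgB; first exact: cvg_cst.
  apply: cvgM; last exact: cvg_cst.
  apply: cvgM; first exact: cvg_cst.
  apply: cvgB; first exact: cvg_cst.
  exact: cvg_id.
suff : l <= f y - f x - mu / 2 * (1 - 0) * enorm (y - x) ^+ 2.
  by rewrite -ld subr0 mulr1; lra.
apply: (ler_cvg_to cl cr); near=> t.
have t0 : 0 < t by near: t; exact: nbhs_right_gt.
have t1 : t < 1 by near: t; exact: nbhs_right_lt.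
rewrite /= [X in X <= _]mulrC ler_pdivrMr //.
have := cvx y x t; rewrite (ltW t0) (ltW t1) => /(_ isT).
rewrite (_ : t *: y + (1 - t) *: x = t *: (y - x) + x); last first.
  by rewrite scalerBr scalerBl scale1r addrA addrAC.
nra.
Unshelve. all: by end_near. Qed.

Lemma strongly_convex_gradient_monotone f mu x y :
  (forall z, differentiable f z) -> strongly_convex mu f ->
  mu * enorm (y - x) ^+ 2 <= dot (y - x) (gradient f y - gradient f x).
Proof.
move=> df cvx.
have := strongly_convex_gradient y (df x) cvx.
have := strongly_convex_gradient x (df y) cvx.
rewrite (enormB x y) -(opprB y x) dotNr (dotC (y - x)) dotBl; lra.
Qed.

(** The right side is the derivative at [0] of [t |-> dot v (gradient f (x + t *: v))], and
    monotonicity of the gradient bounds its difference quotients for [t > 0] from below. *)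
Lemma strongly_convex_hessian f mu x v :
  twice_differentiable f -> strongly_convex mu f ->
  mu * enorm v ^+ 2 <= dot v (hessian f x *m v).
Proof.
move=> [df dg] cvx; have [D Dv] := is_derive_dot_gradient x v v 0 dg.
rewrite scale0r addr0 in Dv; move: D => /cvg_ex[l cl].
have {}Dv : l = dot v (hessian f x *m v).
  by rewrite -Dv; apply/esym/cvg_lim.
rewrite -Dv; apply: (cvgr_to_ge (cvg_dnbhs_at_right cl)); near=> t.
have t0 : 0 < t by near: t; exact: nbhs_right_gt.
rewrite /= mulrC scale0r !addr0 [leRHS]mulrC ler_pdivlMr // [t%:A]mulr1.
have := strongly_convex_gradient_monotone x (x + t *: v) df cvx.
rewrite addrAC subrr add0r enormZ (ger0_norm (ltW t0)) dotZl dotBr; nra.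
Unshelve. all: by end_near. Qed.

End Gradient.

(** * Laplacians of symmetric substochastic matrices and their square roots *)

Section SubstochasticLaplacian.
Context {R : realType} {m : nat}.
Implicit Types (W Y : 'M[R]_m) (x : 'cV[R]_m).

(** Row sums are only bounded by [1], because the approximations of the square root built below
    start from the zero matrix. *)
Record sym_substochastic W : Prop := {
  substo_sym : W^T = W;
  substo_ge0 : forall i j, 0 <= W i j;
  substo_le1 : forall i, \sum_j W i j <= 1 }.

Lemma substo_symE W i j : sym_substochastic W -> W i j = W j i.
Proof. by case=> Ws _ _; rewrite -{1}Ws mxE. Qed.

(** Dirichlet form of the weighted graph plus the deficit of the row sums. Positivity and the kernel
    of the Laplacian are both read off this sum of squares. *)
Lemma dot_laplacian W x : sym_substochastic W ->
  2 * dot x ((1%:M - W) *m x) =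
  \sum_i \sum_j W i j * (x i 0 - x j 0) ^+ 2
  + 2 * \sum_i (1 - \sum_j W i j) * x i 0 ^+ 2.
Proof.
move=> HW; rewrite mulmxBl mul1mx dotBr.
have E1 : dot x (W *m x) = \sum_i \sum_j W i j * (x i 0 * x j 0).
  rewrite dotE; apply: eq_bigr => i _; rewrite mxE mulr_sumr.
  by apply: eq_bigr => j _; ring.
have E2 : \sum_i \sum_j W i j * x j 0 ^+ 2 = \sum_i \sum_j W i j * x i 0 ^+ 2.
  rewrite exchange_big; apply: eq_bigr => i _; apply: eq_bigr => j _.
  by rewrite (substo_symE _ _ HW).
have -> : \sum_i \sum_j W i j * (x i 0 - x j 0) ^+ 2 =
    \sum_i \sum_j W i j * x i 0 ^+ 2 + \sum_i \sum_j W i j * x j 0 ^+ 2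
    - 2 * \sum_i \sum_j W i j * (x i 0 * x j 0).
  rewrite mulr_sumr -big_split -sumrB; apply: eq_bigr => i _ /=.
  rewrite mulr_sumr -big_split -sumrB; apply: eq_bigr => j _ /=.
  ring.
have -> : \sum_i (1 - \sum_j W i j) * x i 0 ^+ 2 =
    dot x x - \sum_i \sum_j W i j * x i 0 ^+ 2.
  rewrite dotE -sumrB; apply: eq_bigr => i _.
  by rewrite -mulr_suml; ring.
rewrite E1 E2; ring.
Qed.

Lemma laplacian_ge0 W x : sym_substochastic W ->
  0 <= dot x ((1%:M - W) *m x).
Proof.
move=> HW; rewrite -(pmulr_rge0 _ (ltr0n R 2)) dot_laplacian //.
rewrite addr_ge0 ?mulr_ge0 // sumr_ge0 // => i _.
  by rewrite sumr_ge0 // => j _; rewrite mulr_ge0 ?sqr_ge0 ?substo_ge0.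
by rewrite mulr_ge0 ?sqr_ge0 // subr_ge0 substo_le1.
Qed.

(** Jensen's inequality on each row, then summation over the rows, with column sums at most [1] by
    symmetry. *)
Lemma substo_enorm W x : sym_substochastic W -> enorm (W *m x) <= enorm x.
Proof.
move=> HW; rewrite -ler_sqr ?nnegrE ?enorm_ge0 // !enorm_sqr !dotE.
apply: (@le_trans _ _ (\sum_i \sum_j W i j * x j 0 ^+ 2)).
  apply: ler_sum => i _; set a := (W *m x) i 0.
  (* Expanded, this gives [(2 - \sum_j W i j) * a ^+ 2 <= \sum_j W i j * x j 0 ^+ 2], where the
     first factor is at least [1]. *)
  have: 0 <= \sum_j W i j * (x j 0 - a) ^+ 2.
    by rewrite sumr_ge0 // => j _; rewrite mulr_ge0 ?sqr_ge0 ?substo_ge0.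
  have -> : \sum_j W i j * (x j 0 - a) ^+ 2 =
      \sum_j W i j * x j 0 ^+ 2 - 2 * a * a + (\sum_j W i j) * a ^+ 2.
    rewrite {3}/a mxE mulr_sumr mulr_suml -sumrB -big_split.
    by apply: eq_bigr => j _ /=; ring.
  by have := substo_le1 HW i; have := sqr_ge0 a; nra.
rewrite exchange_big; apply: ler_sum => j _; rewrite -mulr_suml -expr2.
rewrite ler_piMl ?sqr_ge0 // (eq_bigr _ (fun i _ => substo_symE i j HW)).
exact: substo_le1.
Qed.

(* Monotone iteration for [Y = (W + Y ^ 2) / 2], whose solution satisfies
   [(1 - Y) ^ 2 = 1 - W]. *)
Definition sqrt_iter W k : 'M[R]_m :=
  iter k (fun Y => 2^-1 *: (W + Y *m Y)) 0.

Lemma sqrt_iterS W k :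
  sqrt_iter W k.+1 = 2^-1 *: (W + sqrt_iter W k *m sqrt_iter W k).
Proof. by []. Qed.

Lemma sqrt_iter_substochastic W k :
  sym_substochastic W -> sym_substochastic (sqrt_iter W k).
Proof.
move=> HW; elim: k => [|k [Ys Y0 Y1]].
  split=> [|i j|i]; rewrite /sqrt_iter /= ?trmx0 ?mxE //.
  by rewrite big1 // => j _; rewrite mxE.
rewrite sqrt_iterS; split=> [|i j|i].
- by rewrite linearZ linearD /= trmx_mul Ys (substo_sym HW).
- by rewrite !mxE mulr_ge0 ?invr_ge0 ?addr_ge0 ?substo_ge0 ?sumr_ge0 // => l _;
     rewrite mulr_ge0.
- under eq_bigr do rewrite mxE; rewrite -mulr_sumr mulrC ler_pdivrMr // mul1r.
  under eq_bigr do rewrite mxE; rewrite big_split /= lerD ?(substo_le1 HW) //.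
  under eq_bigr do rewrite mxE; rewrite exchange_big /=.
  apply: (le_trans _ (Y1 i)); apply: ler_sum => l _.
  by rewrite -mulr_sumr ler_piMr.
Qed.

(** On matrices with nonnegative entries, squaring preserves the entrywise order. *)
Lemma nondecreasing_sqrt_iter W i j : sym_substochastic W ->
  nondecreasing_seq (fun k => sqrt_iter W k i j).
Proof.
move=> HW; apply/nondecreasing_seqP => k; elim: k i j => [|k IH] i j.
  rewrite (_ : sqrt_iter W 0 = 0) // [leLHS]mxE.
  exact: substo_ge0 (sqrt_iter_substochastic 1 HW) _ _.
have Y0 := substo_ge0 (sqrt_iter_substochastic k HW).
rewrite (sqrt_iterS _ k.+1) {1}sqrt_iterS !mxE ler_wpM2l ?invr_ge0 // lerD2l.
by apply: ler_sum => l _; rewrite ler_pM.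
Qed.

Lemma cvg_sqrt_iter W i j : sym_substochastic W ->
  cvg (sqrt_iter W k i j @[k --> \oo]).
Proof.
move=> HW; apply: nondecreasing_is_cvgn; first exact: nondecreasing_sqrt_iter.
exists 1 => _ [k _ <-]; have Y := sqrt_iter_substochastic k HW.
apply: (le_trans _ (substo_le1 Y i)); rewrite (bigD1 j) //= lerDl.
by rewrite sumr_ge0 // => l _; apply: substo_ge0.
Qed.

(** [sqrtmx] falls back to [0] on a matrix without a root, so existence is what gives [feasible] its
    meaning. The entrywise limit [Y] of the iterates is again substochastic, which makes [1%:M - Y]
    positive semidefinite. *)
Lemma ex_sqrtmx_laplacian W : sym_substochastic W ->
  exists S, psdmx S /\ S *m S = 1%:M - W.
Proof.
move=> HW; pose Y : 'M[R]_m := \matrix_(i, j) lim (sqrt_iter W k i j @[k --> \oo]).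
have cY i j : sqrt_iter W k i j @[k --> \oo] --> Y i j.
  by rewrite mxE; apply: cvg_sqrt_iter.
have HY : sym_substochastic Y.
  split=> [|i j|i].
  - apply/matrixP => i j; rewrite !mxE.
    rewrite (_ : (fun k => sqrt_iter W k j i) = fun k => sqrt_iter W k i j) //.
    apply/funext => k.
    exact: substo_symE (sqrt_iter_substochastic k HW).
  - apply: (cvgr_to_ge (cY i j)); near=> k.
    exact: substo_ge0 (sqrt_iter_substochastic k HW) _ _.
  - apply: (cvgr_to_le (cvg_sum (cY i))); near=> k.
    exact: substo_le1 (sqrt_iter_substochastic k HW) _.
have YE : Y = 2^-1 *: (W + Y *m Y).
  apply/matrixP => i j; apply: (@cvg_unique _ _ (sqrt_iter W k.+1 i j @[k --> \oo])).
  - exact: Rhausdorff.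
  - by have := cY i j; rewrite -cvg_shiftS.
  - rewrite 3!mxE.
    rewrite (_ : (fun k => sqrt_iter W k.+1 i j) = fun k =>
        2^-1 * (W i j + \sum_l sqrt_iter W k i l * sqrt_iter W k l j)); last first.
      by apply/funext => k; rewrite sqrt_iterS 3!mxE.
    apply: cvgM; first exact: cvg_cst.
    apply: cvgD; first exact: cvg_cst.
    by apply: cvg_sum => l; apply: cvgM; apply: cY.
exists (1%:M - Y); split; last first.
  rewrite mulmxBl mulmxBr !mul1mx mulmxBr mulmx1.
  move/(congr1 (fun M => 2 *: M)): YE; rewrite scalerA divff ?pnatr_eq0 // scale1r.
  move/esym/(canRL (addrK _)) => ->.
  by apply/matrixP => i j; rewrite !mxE; ring.
split=> [|x]; first by rewrite linearB /= trmx1 substo_sym.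
by rewrite -mulmxA; apply: laplacian_ge0.
Unshelve. all: by end_near. Qed.

(** For the root [S], symmetry gives [enorm (S *m x) ^+ 2 = dot x (S *m S *m x)]. *)
Lemma sqrtmx_laplacian_eq0 W x : sym_substochastic W ->
  (sqrtmx (1%:M - W) *m x = 0) <-> ((1%:M - W) *m x = 0).
Proof.
move=> HW; have [[Ss _] SS] := xgetPex 0 (ex_sqrtmx_laplacian HW).
rewrite -/(sqrtmx _) in Ss SS; rewrite -{2}SS -mulmxA; split=> [->|E].
  by rewrite mulmx0.
apply/eqP; rewrite -enorm_eq0 -sqrf_eq0 enorm_sqr dot_mulmxl Ss E.
by rewrite dot0r.
Qed.

Lemma laplacian_enorm W x : sym_substochastic W ->
  enorm ((1%:M - W) *m x) <= 2 * enorm x.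
Proof.
move=> HW; rewrite mulmxBl mul1mx; apply: (le_trans (ler_enormB _ _)).
by rewrite mulrDl mul1r lerD2l substo_enorm.
Qed.

End SubstochasticLaplacian.

(** * Stacked vectors, Kronecker product with the identity, consensus *)

Section Blocks.
Context {R : realType} {N n : nat}.
Local Notation vec := 'cV[R]_(\sum_(i < N) n).
Implicit Types (W : 'M[R]_N) (x u v : vec).

(** Makes block extraction a matrix product; the transpose puts a block back in position [i], with
    zeros elsewhere. *)
Definition blockmx (i : 'I_N) : 'M[R]_(n, \sum_(i < N) n) := submxcol 1%:M i.

Lemma blockE x i : block x i = blockmx i *m x.
Proof. by rewrite /block /blockmx submxcol_mul mul1mx. Qed.

Lemma block_mxcol (y : 'I_N -> 'cV[R]_n) i : block (\mxcol_j y j) i = y i.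
Proof. exact: mxcolK. Qed.

Lemma mxcol_block x : \mxcol_i block x i = x.
Proof. exact: submxcolK. Qed.

Lemma dot_block u v : dot u v = \sum_i dot (block u i) (block v i).
Proof.
rewrite /dot -{1}(mxcol_block u) -{1}(mxcol_block v) tr_mxcol mul_mxrow_mxcol.
by rewrite summxE.
Qed.

Lemma enorm_block x : enorm x ^+ 2 = \sum_i enorm (block x i) ^+ 2.
Proof.
by rewrite enorm_sqr dot_block; apply: eq_bigr => i _; rewrite enorm_sqr.
Qed.

Lemma sum_blockmx_tr (y : 'I_N -> 'cV[R]_n) :
  \sum_i (blockmx i)^T *m y i = \mxcol_i y i.
Proof.
apply/colP => k; rewrite -!dot_delta !(dotC _ (delta_mx _ _)) dot_sumr dot_block.
by apply: eq_bigr => i _; rewrite dot_mulmxr trmxK -blockE block_mxcol.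
Qed.

Lemma block_kronI W x i : block (kronI W *m x) i = \sum_j W i j *: block x j.
Proof.
rewrite -{1}(mxcol_block x) mul_mxblock_mxrow block_mxcol.
by apply: eq_bigr => j _; rewrite mul_scalar_mx.
Qed.

Lemma laplacian_consensus W (y : 'cV[R]_n) :
  doubly_stochastic W -> laplacian W *m (\mxcol_(i < N) y) = 0.
Proof.
move=> [_ W1 _]; rewrite mulmxBl mul1mx; apply/eqP; rewrite subr_eq0 eq_sym.
apply/eqP/mxcolP => i; rewrite -[LHS]/(block _ i) -[RHS]/(block _ i).
rewrite block_kronI; under eq_bigr do rewrite block_mxcol.
by rewrite -scaler_suml W1 scale1r block_mxcol.
Qed.

Lemma kronI_row_sum W (k : 'I_(\sum_(i < N) n)) :
  doubly_stochastic W -> \sum_l kronI W k l = 1.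
Proof.
(* The Laplacian kills the all-ones vector; its row [k] is the claim. *)
move=> dW; have /colP/(_ k) := laplacian_consensus (const_mx 1) dW.
rewrite mulmxBl mul1mx mxcol_const !mxE => /eqP; rewrite subr_eq0 => /eqP ->.
by apply: eq_bigr => l _; rewrite [X in _ * X]mxE mulr1.
Qed.

Lemma kronI_substochastic W :
  W^T = W -> doubly_stochastic W ->
  sym_substochastic (kronI W : 'M[R]_(\sum_(i < N) n)).
Proof.
move=> Ws dW; split=> [|k l|k]; last by rewrite kronI_row_sum.
  rewrite tr_mxblock; apply: eq_mxblock => i j.
  by rewrite tr_scalar_mx -{1}Ws mxE.
by rewrite !mxE mulrn_wge0 //; case: dW.
Qed.

(** The quadratic form vanishes at [x] and the row deficits are zero, so every weighted square is
    zero. Positive weights on edges equate neighbouring blocks, and connectivity propagates the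
    equality along paths. *)
Lemma laplacian_ker (e : rel 'I_N) W x : network_assumption e W ->
  laplacian W *m x = 0 -> forall i j, block x i = block x j.
Proof.
move=> netW Lx0; have dW := weights_stochastic netW.
have HK := kronI_substochastic (weights_symmetric netW) dW.
have := dot_laplacian x HK; rewrite -/(laplacian W) Lx0 dot0r mulr0.
rewrite [X in _ + 2 * X]big1 ?mulr0 ?addr0 => [/esym|k _]; last first.
  by rewrite kronI_row_sum // subrr mul0r.
have Kge0 k l : 0 <= kronI W k l * (x k 0 - x l 0) ^+ 2.
  by rewrite mulr_ge0 ?sqr_ge0 ?(substo_ge0 HK).
move/psumr_eq0P => K0.
have {}K0 k l : kronI W k l * (x k 0 - x l 0) ^+ 2 = 0.
  have /psumr_eq0P : \sum_l kronI W k l * (x k 0 - x l 0) ^+ 2 = 0.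
    by apply: K0 => // i _; rewrite sumr_ge0.
  by apply.
have adj i j : e i j -> block x i = block x j.
  move=> eij; apply/colP => c.
  have W0 : 0 < W i j by apply: (weights_pos netW); rewrite eij orbT.
  have /eqP := K0 (tagnat.Rank i c) (tagnat.Rank j c).
  have -> : kronI W (tagnat.Rank i c) (tagnat.Rank j c) = W i j.
    have /matrixP/(_ c c) := mxblockK (fun i j => (W i j)%:M : 'M[R]_n) i j.
    by rewrite [in RHS]mxE eqxx mulr1n [in LHS]mxE.
  rewrite mulf_eq0 gt_eqF //= sqrf_eq0 subr_eq0 => /eqP xE.
  by rewrite /block /submxcol !mxE.
move=> i j; have /connectP[p] := graph_connected netW i j.
by elim: p i => [|k p IH] i /= => [_ ->//|/andP[/adj-> /IH] h /h].
Qed.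

End Blocks.

(** * Calculus of the separable objective *)

Section Objective.
Context {R : realType} {N n : nat}.
Local Notation vec := 'cV[R]_(\sum_(i < N) n).
Implicit Types (f : 'I_N -> 'cV[R]_n -> R) (x v : vec).

(** General values in [V] allow two uses: with the [f i] themselves for the gradient, and with the
    embedded [gradient (f i)] for the Hessian. *)
Lemma diff_sum_comp_block (V : normedModType R) (g : 'I_N -> 'cV[R]_n -> V) x v :
  (forall i y, differentiable (g i) y) ->
  differentiable (fun x => \sum_i g i (block x i)) x /\
  'd (fun x => \sum_i g i (block x i)) x v =
    \sum_i 'd (g i) (block x i) (block v i).
Proof.
move=> dg; pose h i := g i \o mulmx (blockmx i) : vec -> V.
have dM i y : differentiable (mulmx (blockmx i) : vec -> _) y.
  exact: (linear_differentiable _ (@continuous_mulmx _ _ _ _)).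
have dh i y : differentiable (h i) y.
  by apply: differentiable_comp; [exact: dM|exact: dg].
have -> : (fun x => \sum_i g i (block x i)) = \sum_i h i.
  apply/funext => y; rewrite fct_sumE; apply: eq_bigr => i _.
  by rewrite /h /= blockE.
have dS : differentiable (\sum_i h i) x by apply: differentiable_sum => i.
split=> //; rewrite -deriveE // derive_sum => [|i]; last exact: diff_derivable.
apply: eq_bigr => i _; rewrite deriveE // (diff_comp (dM _ _) (dg _ _)) /=.
by rewrite diff_lin ?blockE //; exact: continuous_mulmx.
Qed.

Lemma gradient_objective f x : (forall i y, differentiable (f i) y) ->
  gradient (objective f) x = \mxcol_i gradient (f i) (block x i).
Proof.
move=> df; apply: gradient_eq => [|v]; first exact: (diff_sum_comp_block x 0 df).1.
rewrite (diff_sum_comp_block x v df).2 dot_block; apply: eq_bigr => i _.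
by rewrite block_mxcol diff_gradient.
Qed.

Lemma twice_differentiable_objective f :
  (forall i, twice_differentiable (f i)) -> twice_differentiable (objective f).
Proof.
move=> df; split=> x.
  by apply: (diff_sum_comp_block x 0 _).1 => i; exact: (df i).1.
have dg i y : differentiable (fun y => (blockmx i)^T *m gradient (f i) y) y.
  apply: (@differentiable_comp _ _ _ _ (gradient (f i)) (mulmx (blockmx i)^T)).
    exact: (df i).2.
  exact: (linear_differentiable _ (@continuous_mulmx _ _ _ _)).
rewrite (_ : gradient _ = fun x => \sum_i (blockmx i)^T *m gradient (f i) (block x i)).
  exact: (diff_sum_comp_block x 0 dg).1.
apply/funext => y; rewrite gradient_objective ?sum_blockmx_tr // => i.
exact: (df i).1.
Qed.

Lemma hessian_objective f x v : (forall i, twice_differentiable (f i)) ->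
  hessian (objective f) x *m v = \mxcol_i (hessian (f i) (block x i) *m block v i).
Proof.
move=> df; have [_ dF] := twice_differentiable_objective df.
have dM i y : differentiable (mulmx (blockmx i)^T : 'cV[R]_n -> vec) y.
  exact: (linear_differentiable _ (@continuous_mulmx _ _ _ _)).
have dg i y : differentiable (mulmx (blockmx i)^T \o gradient (f i)) y.
  by apply: differentiable_comp; [exact: (df i).2|exact: dM].
rewrite -diff_hessian // (_ : gradient _ = fun x =>
    \sum_i (mulmx (blockmx i)^T \o gradient (f i)) (block x i)).
  rewrite (diff_sum_comp_block x v dg).2 -sum_blockmx_tr.
  apply: eq_bigr => i _; rewrite (diff_comp ((df i).2 _) (dM _ _)) /=.
  by rewrite diff_lin ?diff_hessian //; [exact: (df i).2|exact: continuous_mulmx].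
apply/funext => y; rewrite gradient_objective ?sum_blockmx_tr // => i.
exact: (df i).1.
Qed.

Lemma strongly_convex_objective f mu :
  (forall i, strongly_convex mu (f i)) -> strongly_convex mu (objective f).
Proof.
move=> cvx x y t t01; rewrite /objective enorm_block !mulr_sumr -big_split -sumrB.
apply: ler_sum => i _ /=; have := cvx i (block x i) (block y i) t t01.
by rewrite !blockE mulmxBr mulmxDr -!scalemxAr.
Qed.

Lemma hessian_objective_le f l x v :
  (forall i, twice_differentiable (f i)) ->
  (forall i y, opnorm (hessian (f i) y) <= l i) ->
  enorm (hessian (objective f) x *m v) <= maxI l * enorm v.
Proof.
move=> df fl; have L0 : 0 <= maxI l by exact: bigmax_ge_id.
rewrite -ler_sqr ?nnegrE ?mulr_ge0 ?enorm_ge0 // exprMn !enorm_block mulr_sumr.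
apply: ler_sum => i _; rewrite hessian_objective // block_mxcol -exprMn.
rewrite ler_sqr ?nnegrE ?mulr_ge0 ?enorm_ge0 //.
apply: (le_trans (ler_opnorm _ _)); rewrite ler_wpM2r ?enorm_ge0 //.
by apply: (le_trans (fl i _)); exact: le_bigmax.
Qed.

End Objective.

(** * Invertibility, comparison of norms, and the number of inner iterations *)

Lemma injective_unitmx (F : fieldType) m (A : 'M[F]_m) :
  (forall v : 'cV[F]_m, A *m v = 0 -> v = 0) -> A \in unitmx.
Proof.
move=> Ainj; rewrite -unitmx_tr -row_free_unit; apply: inj_row_free => v vA.
apply: trmx_inj; rewrite trmx0; apply: Ainj.
by rewrite -[LHS]trmxK trmx_mul trmxK vA trmx0.
Qed.

(** Boundedness of the sequence refers to the maximum norm, the estimates to the Euclidean one. *)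
Lemma enorm_le_norm (R : realType) m (x : 'cV[R]_m) :
  enorm x <= Num.sqrt m%:R * `|x|.
Proof.
rewrite -ler_sqr ?nnegrE ?mulr_ge0 ?enorm_ge0 ?sqrtr_ge0 //.
rewrite exprMn enorm_sqr dotE sqr_sqrtr // mulr_natl.
have -> : `|x| ^+ 2 *+ m = \sum_(i < m) `|x| ^+ 2 by rewrite sumr_const card_ord.
apply: ler_sum => i _; rewrite -expr2 -real_normK ?num_real //.
rewrite ler_sqr ?nnegrE // [leRHS]/Num.norm /= mx_normrE.
exact: (le_bigmax _ (fun ij : 'I_m * 'I_1 => `|x ij.1 ij.2|) (i, 0)).
Qed.

(** Absolute value and ceiling only enlarge the quotient. Multiplying by [ln rho], which is
    negative, gives [k%:R * ln rho <= ln a - ln b], the logarithm of the claim. *)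
Lemma ler_expr_of_ceil (R : realType) (k : nat) (rho a b : R) :
  0 < rho < 1 -> 0 < a -> 0 < b ->
  k%:Z = Num.ceil `|(ln a - ln b) / ln rho| -> rho ^+ k * b <= a.
Proof.
move=> rho01 a0 b0 kE; have /andP[rho0 _] := rho01.
have : (ln a - ln b) / ln rho <= k%:R.
  by rewrite (le_trans (ler_norm _)) // pmulrn kE ceil_ge.
rewrite ler_ndivrMr ?ln_lt0 // => h.
rewrite -ler_ln ?posrE ?mulr_gt0 ?exprn_gt0 // lnM ?posrE ?exprn_gt0 //.
by rewrite lnXn // -mulr_natl; lra.
Qed.

(** * Contraction of the Jacobi over-relaxation iteration *)

Section JOR.
Context {R : realType} {N n : nat}.
Local Notation vec := 'cV[R]_(\sum_(i < N) n).
Local Notation mat := 'M[R]_(\sum_(i < N) n).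
Implicit Types (A : mat) (c y z : vec).

Lemma diagpart_unitmx A : (forall i, A i i != 0) -> diagpart A \in unitmx.
Proof.
move=> A0; rewrite unitmxE det_diag unitfE; apply/prodf_neq0 => i _.
by rewrite mxE.
Qed.

(** The solution [y] is a fixed point of the affine step for every [q], so the error evolves by the
    linear part alone. *)
Lemma jor_step_sub q A c y z : (forall i, A i i != 0) -> A *m y = c ->
  jor_step q A c z - y = jor_mx q A *m (z - y).
Proof.
move=> /diagpart_unitmx uD Ay.
have yfix : jor_mx q A *m y + jor_vec q A c = y.
  rewrite /jor_mx /jor_vec mulmxDl -!scalemxAl mul1mx -mulmxA mulmxBl Ay mulmxBr.
  rewrite mulKmx //; set d := invmx _ *m c.
  by apply/colP => i; rewrite !mxE; ring.
by rewrite -{1}yfix /jor_step mulmxBr opprD addrACA subrr addr0.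
Qed.

Lemma iter_jor_step k q A c y z rho : (forall i, A i i != 0) -> A *m y = c ->
  opnorm (jor_mx q A) <= rho ->
  enorm (iter k (jor_step q A c) z - y) <= rho ^+ k * enorm (z - y).
Proof.
move=> A0 Ay Mrho; have rho0 := le_trans (opnorm_ge0 _) Mrho.
elim: k => [|k IH]; first by rewrite expr0 mul1r.
rewrite iterS jor_step_sub // exprS -mulrA.
apply: (le_trans (ler_opnorm _ _)); apply: ler_pM => //.
  exact: opnorm_ge0.
exact: enorm_ge0.
Qed.

(* The diagonal of [jor_mx q A] is [1 - q]. *)
Lemma opnorm_jor_gt0 q A (i : 'I_(\sum_(i < N) n)) :
  (forall i, A i i != 0) -> q < 1 -> 0 < opnorm (jor_mx q A).
Proof.
move=> A0 q1; rewrite lt0r opnorm_ge0 andbT; apply/eqP => M0.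
have Mi : jor_mx q A *m (delta_mx i 0 : vec) = 0.
  apply/eqP; rewrite -enorm_eq0 eq_le enorm_ge0 andbT.
  by rewrite (le_trans (ler_opnorm _ _)) // M0 mul0r.
have uD := diagpart_unitmx A0.
have /(congr1 (fun v : vec => (diagpart A *m v) i 0)) := Mi.
rewrite /jor_mx mulmxDl -!scalemxAl mul1mx mulmxDr -!scalemxAr mulmxA mulKVmx //.
rewrite mulmx0 -!colE.
by rewrite !mxE eqxx mulr1n subrr mulr0 add0r => /eqP; rewrite mulf_eq0 (negPf (A0 i))
  orbF subr_eq0 gt_eqF.
Qed.

End JOR.

(** * Bounds on the system matrices *)

Section Convergence.
Context {R : realType} {N n : nat}.
Local Notation vec := 'cV[R]_(\sum_(i < N) n).
Context {e : rel 'I_N} {W : 'M[R]_N} {f : 'I_N -> 'cV[R]_n -> R}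
  {mu : R} {l : 'I_N -> R}.
Context (netW : network_assumption e W) (mu_gt0 : 0 < mu)
  (f_diff2 : forall i, twice_differentiable (f i))
  (f_cvx : forall i, strongly_convex mu (f i))
  (f_hess : forall i y, opnorm (hessian (f i) y) <= l i).
Implicit Types (x y z v : vec) (th : R).

Local Notation L := (maxI l).
Local Notation F := (objective f).
Local Notation gradF := (gradient (objective f)).
Local Notation hessF := (hessian (objective f)).
Local Notation LL := (laplacian W : 'M[R]_(\sum_(i < N) n)).

Let maxI_ge0 (g : 'I_N -> R) : 0 <= maxI g.
Proof. exact: bigmax_ge_id. Qed.

Let kronI_substo : sym_substochastic (kronI W : 'M[R]_(\sum_(i < N) n)).
Proof.
exact: kronI_substochastic (weights_symmetric netW) (weights_stochastic netW).
Qed.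

Let F_diff2 : twice_differentiable F.
Proof. exact: twice_differentiable_objective. Qed.

Let hessF_le x v : enorm (hessF x *m v) <= L * enorm v.
Proof. exact: hessian_objective_le. Qed.

Lemma sysmx_coercive th z v : 0 <= th ->
  mu * enorm v ^+ 2 <= dot v (sysmx W f th z *m v).
Proof.
move=> th0; rewrite mulmxDl -scalemxAl dotDr dotZr -[leLHS]addr0 lerD //.
  by apply: strongly_convex_hessian => //; exact: strongly_convex_objective.
by rewrite mulr_ge0 ?laplacian_ge0.
Qed.

(** Cauchy-Schwarz turns coercivity into a bound independent of [th]; it yields invertibility and
    controls the iterates by their residuals. *)
Lemma sysmx_lower th z v : 0 <= th ->
  mu * enorm v <= enorm (sysmx W f th z *m v).
Proof.
move=> th0; have [->|v0] := eqVneq v 0; first by rewrite enorm0 mulr0 enorm_ge0.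
have vg0 : 0 < enorm v by rewrite lt0r enorm_eq0 v0 enorm_ge0.
rewrite -(ler_pM2l vg0) mulrCA -expr2; apply: (le_trans (sysmx_coercive z v th0)).
exact: (le_trans (ler_norm _) (cauchy_schwarz _ _)).
Qed.

(** Source of the factor [L + 2 * th] in the formula for [k s]: the Hessian has norm at most [L],
    the Laplacian at most [2]. *)
Lemma sysmx_upper th z v : 0 <= th ->
  enorm (sysmx W f th z *m v) <= (L + 2 * th) * enorm v.
Proof.
move=> th0; rewrite mulmxDl -scalemxAl; apply: (le_trans (ler_enormD _ _)).
rewrite mulrDl lerD ?hessF_le // enormZ ger0_norm // (mulrC 2) -mulrA.
by rewrite ler_wpM2l // laplacian_enorm.
Qed.

Lemma sysmx_diag_neq0 th z i : 0 <= th -> sysmx W f th z i i != 0.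
Proof.
move=> th0; have := sysmx_coercive z (delta_mx i 0) th0.
rewrite dotC dot_delta enorm_sqr dot_delta -colE !mxE eqxx mulr1 => h.
by rewrite gt_eqF // (lt_le_trans mu_gt0).
Qed.

Lemma sysmx_unitmx th z : 0 <= th -> sysmx W f th z \in unitmx.
Proof.
move=> th0; apply: injective_unitmx => v Av.
have := sysmx_lower z v th0; rewrite Av enorm0 pmulr_rle0 // => v0.
by apply/eqP; rewrite -enorm_eq0 eq_le v0 enorm_ge0.
Qed.

(** * Residuals and limits of the outer iterates *)

Context {theta eps q rho : nat -> R} {k : nat -> nat} {x : nat -> vec}.
Context (theta_gt0 : forall s, 0 < theta s)
  (theta_cvg : theta s @[s --> \oo] --> +oo%R)
  (eps_gt0 : forall s, 0 < eps s)
  (eps_cvg : eps s @[s --> \oo] --> (0 : R))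
  (N_gt0 : (0 < N)%N) (n_gt0 : (0 < n)%N)
  (q_bounds : forall s, (0 < s)%N ->
     0 < q s < 2 * theta s * (1 - wbar W) / (maxI l + 2 * theta s))
  (x_gen : EFIX_G W f theta q k x)
  (rho_bounds : forall s, (0 < s)%N ->
     opnorm (M_ W f theta q x s.+1) <= rho s.+1 < 1)
  (k_def : forall s, (0 < s)%N ->
     (k s)%:Z = Num.ceil `|(ln (mu * eps s.+1)
         - ln ((maxI l + 2 * theta s.+1)
               * (eps s + enorm (c_ f x s) + enorm (c_ f x s.+1))))
       / ln (rho s.+1)|).

Definition residual s : vec := A_ W f theta x s *m x s - c_ f x s.

(** The upper bound on [q s] is at most [1], as [wbar W] and [maxI l] are nonnegative. *)
Let q_lt1 s : (0 < s)%N -> q s < 1.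
Proof.
move=> /q_bounds/andP[_ qs]; apply: (lt_le_trans qs).
have th := theta_gt0 s; have := maxI_ge0 l; have w0 : 0 <= wbar W by exact: maxI_ge0.
move=> L0; rewrite ler_pdivrMr; nra.
Qed.

(** Needed for [ln (rho s.+1)] to be a genuine logarithm. The iteration matrix is nonzero since
    [q s.+1 < 1], and [rho s.+1] dominates its norm. *)
Lemma rho_gt0 s : (0 < s)%N -> 0 < rho s.+1.
Proof.
move=> s0; have /andP[h _] := rho_bounds s0; apply: (lt_le_trans _ h).
apply: (opnorm_jor_gt0 (tagnat.Rank (Ordinal N_gt0) (Ordinal n_gt0))).
  by move=> i; exact/sysmx_diag_neq0/ltW.
exact: q_lt1.
Qed.

(* With [y] the solution of [A_(s+1) y = c_(s+1)], the error [x_s - y] is at most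
   [(|r_s| + |c_s| + |c_(s+1)|) / mu], and the choice of [k s] makes [k s] steps
   of a [rho_(s+1)]-contraction shrink it enough. *)
Lemma residual_step T s : (0 < s)%N -> 1 <= T ->
  enorm (residual s) <= T * eps s -> enorm (residual s.+1) <= T * eps s.+1.
Proof.
move=> s0 T1 rs; set c := enorm (c_ f x s); set c' := enorm (c_ f x s.+1).
have th t : 0 <= theta t by exact/ltW.
pose A := A_ W f theta x s.+1.
pose y := invmx A *m c_ f x s.+1.
have uA : A \in unitmx by exact: sysmx_unitmx.
have Ay : A *m y = c_ f x s.+1 by rewrite mulKVmx.
have y_le : mu * enorm y <= c' by rewrite /c' -Ay sysmx_lower.
have x_le : mu * enorm (x s) <= T * eps s + c.
  apply: (le_trans (sysmx_lower (x s.-1) (x s) (th s))).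
  rewrite -(subrK (c_ f x s) (_ *m _)); apply: (le_trans (ler_enormD _ _)).
  by rewrite lerD2r.
have /andP[Mrho rho1] := rho_bounds s0.
have A0 i : A i i != 0 by exact: sysmx_diag_neq0.
have it := iter_jor_step (k s) (x s) A0 Ay Mrho.
rewrite -x_gen in it.
have -> : residual s.+1 = A *m (x s.+1 - y) by rewrite mulmxBr Ay.
apply: (le_trans (sysmx_upper _ _ (th _))).
have Lth : 0 < L + 2 * theta s.+1.
  by have := theta_gt0 s.+1; have := maxI_ge0 l; lra.
have c0 : 0 <= c by exact: enorm_ge0.
have c'0 : 0 <= c' by exact: enorm_ge0.
have S0 : 0 < eps s + c + c' by have := eps_gt0 s; lra.
have kE := ler_expr_of_ceil _ (mulr_gt0 mu_gt0 (eps_gt0 s.+1))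
  (mulr_gt0 Lth S0) (k_def s0).
have {}kE := kE (introT andP (conj (rho_gt0 s0) rho1)).
have rk0 : 0 <= rho s.+1 ^+ k s by exact/exprn_ge0/ltW/rho_gt0.
(* Here [1 <= T] lets one factor [T] cover [c + c'] as well, leaving the sum that occurs in the
   formula for [k s]. *)
have D_le : mu * enorm (x s - y) <= T * (eps s + c + c').
  have := ler_wpM2l (ltW mu_gt0) (ler_enormB (x s) y); rewrite mulrDr; nra.
have h1 := ler_wpM2l (mulr_ge0 rk0 (ltW Lth)) D_le.
have h2 := ler_wpM2l (le_trans ler01 T1) kE.
have h3 := ler_wpM2l (mulr_ge0 (ltW mu_gt0) (ltW Lth)) it.
rewrite -(ler_pM2l mu_gt0); move: (rho s.+1 ^+ k s) h1 h2 h3 => rk h1 h2 h3.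
lra.
Qed.

Lemma residual_le : exists T, forall s, enorm (residual s.+1) <= T * eps s.+1.
Proof.
pose r := enorm (residual 1) / eps 1%N.
have r0 : 0 <= r by rewrite divr_ge0 ?enorm_ge0 // ltW.
(* The [r] pays for the residual at index [1], produced by the arbitrary [k 0]; the [1] secures the
   condition [1 <= T] of [residual_step]. *)
exists (1 + r); elim=> [|s IH]; last by apply: residual_step => //; rewrite lerDl.
rewrite mulrDl mul1r -[leLHS]add0r lerD ?(ltW (eps_gt0 _)) //.
by rewrite divfK ?gt_eqF.
Qed.

Let gradF_lipschitz y z : enorm (gradF y - gradF z) <= L * enorm (y - z).
Proof. by apply: gradient_lipschitz => // u; exact: F_diff2.2. Qed.

Lemma laplacian_cvg0 B : (forall s, enorm (x s) <= B) ->
  enorm (LL *m x s) @[s --> \oo] --> (0 : R).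
Proof.
move=> xB; have [T rT] := residual_le; have L0 := maxI_ge0 l.
rewrite -(cvg_shiftS (fun s => enorm (LL *m x s))).
(* The absolute value of [T] bounds the residual once [eps s.+1 <= 1]; the three [L * B] bound the
   two Hessian products and [gradF (x s) - gradF 0]. *)
pose C := `|T| + 3 * L * B + enorm (gradF 0).
have cvgC : C / theta s.+1 @[s --> \oo] --> (0 : R).
  rewrite -[X in _ --> X](mulr0 C); apply: cvgM; first exact: cvg_cst.
  rewrite (cvg_shiftS (fun s => (theta s)^-1)).
  by rewrite gtr0_cvgV0 //; exact: nearW.
apply: (squeeze_cvgr _ (cvg_cst 0) cvgC).
have : \forall s \near \oo, eps s.+1 <= 1.
  by apply: (cvgr_le (0 : R)); rewrite ?(cvg_shiftS eps).
apply: filterS => s e1; rewrite enorm_ge0 /= ler_pdivlMr // mulrC.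
rewrite -(ger0_norm (ltW (theta_gt0 s.+1))) -enormZ.
have -> : theta s.+1 *: (LL *m x s.+1) =
    residual s.+1 - hessF (x s) *m x s.+1 + (hessF (x s) *m x s - gradF (x s)).
  rewrite /residual /A_ /sysmx /c_ /sysrhs /= (mulmxDl (hessF (x s))) -scalemxAl.
  by apply/colP => i; rewrite !mxE; ring.
apply: (le_trans (ler_enormD _ _)).
have h1 := ler_enormB (residual s.+1) (hessF (x s) *m x s.+1).
have h2 := ler_enormB (hessF (x s) *m x s) (gradF (x s)).
have h3 := ler_enormD (gradF (x s) - gradF 0) (gradF 0).
rewrite subrK in h3; have h4 := gradF_lipschitz (x s) 0; rewrite subr0 in h4.
have h5 := hessF_le (x s) (x s); have h6 := hessF_le (x s) (x s.+1).
have h7 := ler_wpM2l L0 (xB s); have h8 := ler_wpM2l L0 (xB s.+1).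
have h9 : enorm (residual s.+1) <= `|T|.
  apply: (le_trans (rT s)); apply: (le_trans (ler_norm _)).
  by rewrite normrM ler_piMr // gtr0_norm.
rewrite /C; lra.
Qed.

Let continuous_enorm_laplacian : continuous (fun y => enorm (LL *m y)).
Proof.
move=> y; apply: (@continuous_comp _ _ _ (mulmx LL) (@enorm R _)).
  exact: continuous_mulmx.
exact: continuous_enorm.
Qed.

Let feasibleP y : feasible W y <-> LL *m y = 0.
Proof. exact: sqrtmx_laplacian_eq0. Qed.

(** If [enorm (LL *m y)] were positive, [enorm (LL *m z)] would be below half of it along the tail
    of the sequence and above half of it near [y]; clustering makes these two sets meet. *)
Lemma cluster_feasible B y : (forall s, enorm (x s) <= B) ->
  cluster (x @ \oo) y -> feasible W y.
Proof.
move=> xB cly; apply/feasibleP/eqP; rewrite -enorm_eq0; apply/negPn/negP => g0.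
have gy : 0 < enorm (LL *m y) by rewrite lt0r g0 enorm_ge0.
have y2 : enorm (LL *m y) / 2 < enorm (LL *m y) by lra.
have xl : (x @ \oo) [set z | enorm (LL *m z) < enorm (LL *m y) / 2].
  by apply: (cvgr_lt (0 : R) (laplacian_cvg0 xB)); rewrite divr_gt0.
have cy : enorm (LL *m z) @[z --> y] --> enorm (LL *m y).
  exact: continuous_enorm_laplacian.
have yl := @cvgr_gt _ _ _ (nbhs_filter y) _ _ cy _ y2.
have [z [/= z1 z2]] := cly _ _ xl yl.
by have := lt_trans z1 z2; rewrite ltxx.
Qed.

Context {xstar : vec} (x_cvg : x @ \oo --> xstar).

Lemma cvg_feasible : feasible W xstar.
Proof.
have /cvg_seq_bounded/pinfty_ex_gt0[M _ xM] : cvg (x @ \oo).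
  by apply/cvg_ex; exists xstar.
apply: (@cluster_feasible (Num.sqrt (\sum_(i < N) n)%:R * M)) => [s|].
  by rewrite (le_trans (enorm_le_norm _)) // ler_wpM2l ?sqrtr_ge0 // xM.
move=> P Q xP /x_cvg xQ.
exact: (filter_ex (filterI xP xQ)).
Qed.

(* For [y] in the kernel of the Laplacian, [<y, residual>] does not involve the
   penalty term. *)
Lemma dot_gradient_cvg y : LL *m y = 0 -> dot y (gradF xstar) = 0.
Proof.
move=> Ly; have [T rT] := residual_le; have L0 := maxI_ge0 l.
pose d s := enorm (x s - xstar).
have d0 : d s @[s --> \oo] --> (0 : R).
  have : x s - xstar @[s --> \oo] --> xstar - xstar.
    by apply: cvgB; [exact: x_cvg|exact: cvg_cst].
  by move/(cvg_comp _ _)/(_ (@continuous_enorm _ _ _)); rewrite subrr enorm0.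
have d1 : d s.+1 @[s --> \oo] --> (0 : R) by rewrite (cvg_shiftS d).
have e1 : eps s.+1 @[s --> \oo] --> (0 : R) by rewrite (cvg_shiftS eps).
(* The residual contributes [T * eps s.+1], the Hessian term [L * (d s.+1 + d s)], the gradient
   difference [L * d s]. *)
have u0 : enorm y * (T * eps s.+1 + L * d s.+1 + 2 * L * d s) @[s --> \oo]
    --> enorm y * (T * 0 + L * 0 + 2 * L * 0).
  apply: cvgM; first exact: cvg_cst.
  have cM a (w : nat -> R) b : w s @[s --> \oo] --> b -> a * w s @[s --> \oo] --> a * b.
    by apply: cvgM; exact: cvg_cst.
  by apply: cvgD; [apply: cvgD; exact: cM|exact: cM].
rewrite !mulr0 !addr0 mulr0 in u0.
apply/eqP; rewrite -normr_le0; apply: (cvgr_to_ge u0); apply: nearW => s.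
(* The added increments cancel everything in the residual but the penalty term, which is orthogonal
   to [y] by symmetry of the Laplacian. *)
have -> : dot y (gradF xstar) = dot y (residual s.+1
    - hessF (x s) *m (x s.+1 - x s) + (gradF xstar - gradF (x s))).
  have -> : residual s.+1 - hessF (x s) *m (x s.+1 - x s)
      + (gradF xstar - gradF (x s)) = gradF xstar + theta s.+1 *: (LL *m x s.+1).
    rewrite /residual /A_ /sysmx /c_ /sysrhs /= (mulmxDl (hessF (x s))).
    rewrite -scalemxAl mulmxBr.
    by apply/colP => i; rewrite !mxE; ring.
  rewrite dotDr dotZr dot_mulmxr (_ : LL^T = LL) ?Ly ?(dotC 0) ?dot0r ?mulr0 ?addr0 //.
  by rewrite linearB /= trmx1 (substo_sym kronI_substo).
apply: (le_trans (cauchy_schwarz _ _)); rewrite ler_wpM2l ?enorm_ge0 //.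
apply: (le_trans (ler_enormD _ _)).
have h1 := ler_enormB (residual s.+1) (hessF (x s) *m (x s.+1 - x s)).
have h2 := hessF_le (x s) (x s.+1 - x s).
have h3 : enorm (x s.+1 - x s) <= d s.+1 + d s.
  by rewrite /d (enormB (x s)) (le_trans _ (ler_enormD _ _)) // addrA subrK.
have h4 := gradF_lipschitz xstar (x s); rewrite (enormB xstar) -/(d s) in h4.
have h5 := ler_wpM2l L0 h3; have h6 := rT s.
lra.
Qed.

(** The first-order term at [xstar] vanishes, as [y] and [xstar] both lie in the kernel of the
    Laplacian. *)
Lemma objective_growth y : feasible W y ->
  F xstar + mu / 2 * enorm (y - xstar) ^+ 2 <= F y.
Proof.
move=> /feasibleP Ly; have /feasibleP Lx := cvg_feasible.
have := strongly_convex_gradient y (F_diff2.1 xstar) (strongly_convex_objective f_cvx).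
rewrite dotBr !(dotC (gradF xstar)) !dot_gradient_cvg //; lra.
Qed.

Lemma argmin_feasible : argmin (feasible W) F = [set xstar].
Proof.
apply/seteqP; split=> [y [/= fy miny]|_ -> /=].
  have := objective_growth fy; have := miny _ cvg_feasible => h1 h2.
  apply/eqP; rewrite -subr_eq0 -enorm_eq0 -sqrf_eq0 eq_le sqr_ge0 andbT.
  by rewrite -(pmulr_rle0 _ (divr_gt0 mu_gt0 (ltr0n R 2))); lra.
split=> [|y fy]; first exact: cvg_feasible.
apply: (le_trans _ (objective_growth fy)).
by rewrite lerDl mulr_ge0 ?sqr_ge0 // divr_ge0 // ltW.
Qed.

(** By connectivity, feasible vectors are exactly the stacks of equal blocks, and on these the
    objective is the sum of the [f j]; minimizers of the two problems therefore correspond. *)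
Lemma argmin_consensus (i : 'I_N) :
  argmin setT (fun y : 'cV[R]_n => \sum_(j < N) f j y) = [set block xstar i].
Proof.
have FE (y : 'cV[R]_n) : F (\mxcol_(j < N) y) = \sum_(j < N) f j y.
  by apply: eq_bigr => j _; rewrite block_mxcol.
have fC (y : 'cV[R]_n) : feasible W (\mxcol_(j < N) y : vec).
  by apply/feasibleP/laplacian_consensus/(weights_stochastic netW).
have xE : xstar = \mxcol_(j < N) block xstar i.
  rewrite -{1}(mxcol_block xstar); apply: eq_mxcol => j.
  by apply: (laplacian_ker netW); have /feasibleP := cvg_feasible.
have [_ xmin] : argmin (feasible W) F xstar by rewrite argmin_feasible.
rewrite xE FE in xmin.
apply/seteqP; split=> [y [_ /= ymin]|_ -> /=]; last first.
  by split=> // y _; rewrite -[leRHS]FE; exact: xmin.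
have : argmin (feasible W) F (\mxcol_(j < N) y).
  split=> // z /xmin; apply: le_trans; rewrite FE; exact: ymin.
by rewrite argmin_feasible /= => <-; rewrite block_mxcol.
Qed.

End Convergence.

Theorem theorem4p1 (R : realType) (N n : nat) (N_gt0 : (0 < N)%N)
    (n_gt0 : (0 < n)%N)
    (e : rel 'I_N) (W : 'M[R]_N) (netW : network_assumption e W)
    (wbar_lt1 : wbar W < 1)
    (f : 'I_N -> 'cV[R]_n -> R) (mu : R) (l : 'I_N -> R)
    (mu_gt0 : 0 < mu)
    (f_diff2 : forall i, twice_differentiable (f i))
    (f_cvx : forall i, strongly_convex mu (f i))
    (f_hess : forall i y, opnorm (hessian (f i) y) <= l i)
    (theta eps q rho : nat -> R)
    (theta_gt0 : forall s, 0 < theta s)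
    (theta_cvg : theta s @[s --> \oo] --> +oo%R)
    (eps_gt0 : forall s, 0 < eps s)
    (eps_cvg : eps s @[s --> \oo] --> (0 : R))
    (k : nat -> nat) (x : nat -> 'cV[R]_(\sum_(i < N) n))
    (q_bounds : forall s, (0 < s)%N ->
       0 < q s < 2 * theta s * (1 - wbar W) / (maxI l + 2 * theta s))
    (x_gen : EFIX_G W f theta q k x)
    (rho_bounds : forall s, (0 < s)%N ->
       opnorm (M_ W f theta q x s.+1) <= rho s.+1 < 1)
    (k_def : forall s, (0 < s)%N ->
       (k s)%:Z = Num.ceil `|(ln (mu * eps s.+1)
           - ln ((maxI l + 2 * theta s.+1)
                 * (eps s + enorm (c_ f x s) + enorm (c_ f x s.+1))))
         / ln (rho s.+1)|) :
  (bounded_set (range x) -> cluster (x @ \oo) `<=` feasible W) /\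
  (forall xstar : 'cV[R]_(\sum_(i < N) n), x @ \oo --> xstar ->
     argmin (feasible W) (objective f) = [set xstar] /\
     forall i, argmin setT (fun y => \sum_(j < N) f j y) = [set block xstar i]).
Proof.
have cluster_ok B := cluster_feasible netW mu_gt0 f_diff2 f_cvx f_hess theta_gt0
  theta_cvg eps_gt0 eps_cvg N_gt0 n_gt0 q_bounds x_gen rho_bounds k_def (B := B).
split=> [/pinfty_ex_gt0[B _ xB] y|xstar x_cvg].
  apply: (cluster_ok (Num.sqrt (\sum_(i < N) n)%:R * B)) => s.
  rewrite (le_trans (enorm_le_norm _)) // ler_wpM2l ?sqrtr_ge0 //.
  by apply: xB; exists s.
split=> [|i].
  exact (argmin_feasible netW mu_gt0 f_diff2 f_cvx f_hess theta_gt0 theta_cvg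
    eps_gt0 eps_cvg N_gt0 n_gt0 q_bounds x_gen rho_bounds k_def x_cvg).
exact (argmin_consensus netW mu_gt0 f_diff2 f_cvx f_hess theta_gt0 theta_cvg
  eps_gt0 eps_cvg N_gt0 n_gt0 q_bounds x_gen rho_bounds k_def x_cvg i).
Qed.
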